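(* Let $\mathcal{O}$ be a finite set, let $s \geq 1$ be an integer, and let $f : 2^{\mathcal{O}} \to \mathbb{R}$ be a normalized, monotone decreasing, and $\epsilon$-supermodular set function (so that $f(\mathcal{X}) \leq 0$ for all $\mathcal{X} \subseteq \mathcal{O}$). Let $\mathcal{X}^\star \in \operatorname{argmin}_{\mathcal{X} \subseteq \mathcal{O},\, |\mathcal{X}| \leq s} f(\mathcal{X})$. Then the set $\mathcal{G}_r$ obtained after $r$ steps of the greedy algorithm obeys $$f(\mathcal{G}_r) \leq \left(1 - e^{-r/s}\right) \left[ f(\mathcal{X}^\star) + s \cdot \epsilon \right].$$
   Context: For a set function $f : 2^{\mathcal{O}} \to \mathbb{R}$, $\mathcal{X} \subseteq \mathcal{O}$ and $u \in \mathcal{O} \setminus \mathcal{X}$, let $\Delta_u f(\mathcal{X}) = f(\mathcal{X}) - f(\mathcal{X} \cup \{u\})$. $f$ is normalized if $f(\emptyset) = 0$. $f$ is monotone decreasing if $f(\mathcal{A}) \geq f(\mathcal{B})$ for all $\mathcal{A} \subseteq \mathcal{B} \subseteq \mathcal{O}$. For $\epsilon \in \mathbb{R}$, $f$ is $\epsilon$-supermodular if for all sets $\mathcal{A} \subseteq \mathcal{B} \subseteq \mathcal{O}$ and all $u \in \mathcal{O} \setminus \mathcal{B}$ it holds that $\Delta_u f(\mathcal{A}) \geq \Delta_u f(\mathcal{B}) - \epsilon$. Greedy algorithm: $\mathcal{G}_0 = \emptyset$ and $\mathcal{G}_{j+1} = \mathcal{G}_j \cup \{u\}$ with $u \in \operatorname{argmin}_{w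 \in \mathcal{O} \setminus \mathcal{G}_j} f(\mathcal{G}_j \cup \{w\})$ (ties broken arbitrarily). The number of steps $r$ is a nonnegative integer with $r \leq |\mathcal{O}|$, so that every step is defined. *)

(* Defs.v *)
From mathcomp Require Import all_boot all_order all_algebra.
From mathcomp Require Import reals.

Set Implicit Arguments.
Unset Strict Implicit.
Unset Printing Implicit Defensive.

Import Order.TTheory GRing.Theory Num.Theory.
Local Open Scope ring_scope.

Section SetFunctions.
Context {R : realType} {O : finType}.
Implicit Types (f : {set O} -> R) (X A B : {set O}) (u : O).

(* Total in [u]: it is [0] when [u \in X], but only used for [u \notin X]. *)
Definition marginal f u X : R := f X - f (u |: X).

Definition normalized f : Prop := f set0 = 0.

Definition monotone_decreasing f : Prop :=
  forall A B, A \subset B -> f B <= f A.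

Definition eps_supermodular (eps : R) f : Prop :=
  forall A B u, A \subset B -> u \notin B ->
    marginal f u B - eps <= marginal f u A.

Definition is_argmin (T : Type) (P : T -> Prop) (F : T -> R) (x : T) : Prop :=
  P x /\ forall y, P y -> F x <= F y.

(* [G 0], ..., [G r] are the iterates of some run of the greedy algorithm, under
   any tie-breaking; the values of [G] beyond [r] are irrelevant. *)
Definition greedy_run f (r : nat) (G : nat -> {set O}) : Prop :=
  G 0%N = set0 /\
  forall j : nat, (j < r)%N ->
    exists2 u, is_argmin (fun w => w \notin G j) (fun w => f (w |: G j)) u
             & G j.+1 = u |: G j.

End SetFunctions.

(* Main.v *)
Require Import Defs.
From mathcomp Require Import all_boot all_order all_algebra.
From mathcomp Require Import reals sequences exp.
From mathcomp Require Import lra.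
Import Order.TTheory GRing.Theory Num.Theory.
Local Open Scope ring_scope.

(** Put [v := f Xstar + s * eps].  Adding the elements of [Xstar] one at a time
    to [G j] decreases [f] by at least [f (G j) - f Xstar], because [f] is
    decreasing.  By approximate supermodularity each of these additions, of
    which there are at most [s], gains at most [eps] more than it would have
    gained directly on top of [G j], and there no element gains more than the greedy one.  Hence
    [f (G j) - f Xstar <= s * (f (G j) - f (G j.+1) + eps)]
    ([greedy_step_gain]), which rearranges to
    [f (G j.+1) - v <= (1 - 1/s) * (f (G j) - v)].  As [f (G 0) - v = - v],
    iterating bounds [f (G r) - v] by [(1 - 1/s)^r * (- v)], and
    [1 - 1/s <= exp (- 1/s)] concludes when [v <= 0].  When [v > 0] the
    bound is nonnegative while [f (G r) <= f set0 = 0]. *)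

(** Take both sets in the definition equal to [A]: the marginals cancel. *)
Lemma eps_supermodular_ge0 {R : realType} {O : finType} {eps : R}
    {f : {set O} -> R} {A : {set O}} {u : O} :
  eps_supermodular eps f -> u \notin A -> 0 <= eps.
Proof. by move=> sup uA; have := sup A A u (subxx A) uA; lra. Qed.

(** Telescope along the elements of [B] in any order: each new element is
    inserted in a superset of [A], where its marginal exceeds the one at [A] by
    at most [eps]. *)
Lemma eps_supermodular_setU {R : realType} {O : finType} {eps : R}
    {f : {set O} -> R} {A B : {set O}} :
  eps_supermodular eps f -> [disjoint A & B] ->
  f A - f (A :|: B) <= \sum_(w in B) (marginal f w A + eps).
Proof.
move=> sup; have [n] := ubnP #|B|; elim: n B => // n IHn B.
have [->|/set0Pn[w wB]] := eqVneq B set0; first by rewrite setU0 big_set0 subrr.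
rewrite (cardsD1 w) (big_setD1 w) // wB ltnS => Bn dAB.
have dAB' : [disjoint A & B :\ w] := disjointWr (subsetDl B [set w]) dAB.
have wA : w \notin A by rewrite (disjointFl dAB wB).
have wAB : w \notin A :|: B :\ w by rewrite !inE eqxx orbF.
have -> : A :|: B = w |: (A :|: B :\ w) by rewrite setUCA setD1K.
have := sup A (A :|: B :\ w) w (subsetUl _ _) wAB.
have := IHn _ Bn dAB'.
by rewrite /marginal /=; lra.
Qed.

(** Only the elements of [X] outside [A] have to be added; the unused part of
    the budget [s] costs nothing as [f A - f (u |: A) + eps] is nonnegative. *)
Lemma greedy_step_gain {R : realType} {O : finType} {s : nat} {eps : R}
    {f : {set O} -> R} {X A : {set O}} {u : O} :
  monotone_decreasing f -> eps_supermodular eps f -> (#|X| <= s)%N ->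
  is_argmin (fun w => w \notin A) (fun w => f (w |: A)) u ->
  f A - f X <= s%:R * (f A - f (u |: A) + eps).
Proof.
move=> decr sup Xs [uA umin].
have eps0 := eps_supermodular_ge0 sup uA.
have gain0 : 0 <= f A - f (u |: A) + eps.
  by rewrite addr_ge0 // subr_ge0 decr // subsetUr.
have dAXA : [disjoint A & X :\: A].
  by rewrite disjoint_sym -setI_eq0 setIDAC setDIl setDv setI0.
have fAX : f A - f X <= f A - f (A :|: X :\: A).
  by rewrite lerD2l lerN2 decr // -subDset.
apply: (le_trans fAX).
apply: (le_trans (eps_supermodular_setU sup dAXA)).
apply: (@le_trans _ _ (\sum_(w in X :\: A) (f A - f (u |: A) + eps))).
  apply: ler_sum => w /setDP[_ wA].
  by rewrite /marginal lerD2r lerD2l lerN2 umin.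
rewrite sumr_const -[leLHS]mulr_natl ler_wpM2r // ler_nat.
exact: leq_trans (subset_leq_card (subsetDl X A)) Xs.
Qed.

Theorem theorem2 (R : realType) (O : finType) (s : nat) (eps : R)
    (f : {set O} -> R) (Xstar : {set O}) (r : nat) (G : nat -> {set O})
    (s_ge1 : (1 <= s)%N)
    (f_norm : normalized f)
    (f_decr : monotone_decreasing f)
    (f_super : eps_supermodular eps f)
    (Xstar_min : is_argmin (fun X : {set O} => (#|X| <= s)%N) f Xstar)
    (r_le : (r <= #|O|)%N)
    (G_greedy : greedy_run f r G) :
  f (G r) <= (1 - expR (- (r%:R / s%:R))) * (f Xstar + s%:R * eps).
Proof.
have [G0 Gstep] := G_greedy; have [Xs _] := Xstar_min.
set v := f Xstar + _; set q : R := 1 - s%:R^-1.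
have s0 : 0 < s%:R :> R by rewrite ltr0n.
have q0 : 0 <= q by rewrite subr_ge0 invf_le1 // ler1n.
have gap j : (j <= r)%N -> f (G j) - v <= q ^+ j * (- v).
  elim: j => [|j IHj] jr; first by rewrite G0 f_norm expr0 mul1r sub0r.
  have [u umin Gj] := Gstep j jr.
  apply: (@le_trans _ _ (q * (f (G j) - v))); last first.
    by rewrite exprS -mulrA ler_wpM2l // IHj // ltnW.
  have := greedy_step_gain f_decr f_super Xs umin.
  rewrite -Gj => gain.
  have : s%:R^-1 * (f (G j) - v) <= f (G j) - f (G j.+1).
    by rewrite mulrC ler_pdivrMr // /v; lra.
  by rewrite /q; lra.
have [v0|v0] := lerP v 0; last first.
  apply: (@le_trans _ _ 0); first by rewrite -f_norm f_decr // sub0set.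
  rewrite mulr_ge0 ?(ltW v0) // subr_ge0.
  by rewrite -[leRHS]expR0 ler_expR oppr_le0 divr_ge0.
have qr : q ^+ r <= expR (- (r%:R / s%:R)).
  rewrite -mulrN mulrC expRM_natr lerXn2r ?nnegrE ?expR_ge0 //.
  exact: expR_ge1Dx.
have : q ^+ r * (- v) <= expR (- (r%:R / s%:R)) * (- v).
  by rewrite ler_wpM2r // oppr_ge0.
by have := gap r (leqnn r); lra.
Qed.
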